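(* For any signed permutation matrices $\chi_1,\chi_2,\chi_3$, the signed patterns $$\begin{pmatrix}\chi_1&0&0\\0&\chi_2&0\\0&0&\chi_3\end{pmatrix}\quad\text{and}\quad\begin{pmatrix}\chi_1&0&0\\0&-\chi_2&0\\0&0&\chi_3\end{pmatrix}$$ are Wilf equivalent.
   Context: A signed permutation matrix of size $n$ is an $n\times n$ matrix with entries in $\{0,1,-1\}$ having exactly one nonzero entry in every row and every column; $B_n$ is the set of these. An element $\pi\in B_n$ contains a signed permutation matrix $\tau$ if $\tau$ is a submatrix of $\pi$ (rows and columns kept in order); otherwise $\pi$ avoids $\tau$. $B_n(\tau)$ is the set of elements of $B_n$ avoiding $\tau$. Two signed patterns $\sigma,\tau$ are Wilf equivalent, $\sigma\sim\tau$, if $|B_n(\sigma)|=|B_n(\tau)|$ for every $n\ge1$. *)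

(* Defs.v *)
(* MathComp *)
From HB Require Import structures.
From mathcomp Require Import all_boot all_order all_algebra.

Set Implicit Arguments.
Unset Strict Implicit.
Unset Printing Implicit Defensive.

Import GRing.Theory.
Local Open Scope ring_scope.

Definition is_signed_perm_mx n (A : 'M[int]_n) : bool :=
  [&& [forall i, forall j, A i j \in [:: 0; 1; -1]],
      [forall i, #|[set j | A i j != 0]| == 1%N] &
      [forall j, #|[set i | A i j != 0]| == 1%N]].

(* B_n *)
Record signed_perm_mx (n : nat) := SignedPermMx {
  signed_perm_mx_val :> 'M[int]_n;
  _ : is_signed_perm_mx signed_perm_mx_val
}.

HB.instance Definition _ n := [isSub for @signed_perm_mx_val n].
HB.instance Definition _ n := [Countable of signed_perm_mx n by <:].

(* 'M[int]_n is infinite, so finiteness of B_n is obtained by encoding the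
   entries 0, 1, -1 in the finite type option bool. *)
Definition signed_perm_mx_enc n (A : signed_perm_mx n) : 'M[option bool]_n :=
  map_mx (fun x : int => if x == 0 then None else Some (x == 1))
    (signed_perm_mx_val A).

Definition signed_perm_mx_dec n (M : 'M[option bool]_n) :
    option (signed_perm_mx n) :=
  insub (map_mx (fun o : option bool =>
    if o is Some b then if b then 1 else -1 else 0 : int) M).

Lemma signed_perm_mx_encK n :
  pcancel (@signed_perm_mx_enc n) (@signed_perm_mx_dec n).
Proof.
move=> A; rewrite /signed_perm_mx_dec.
suff -> : map_mx (fun o : option bool =>
    if o is Some b then if b then 1 else -1 else 0 : int)
    (signed_perm_mx_enc A) = val A by rewrite valK.
apply/matrixP=> i j; rewrite !mxE.
case/and3P: (valP A) => /forallP /(_ i) /forallP /(_ j) Aij _ _.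
by move: Aij; rewrite !inE => /or3P[] /eqP ->.
Qed.

HB.instance Definition _ n :=
  isFinite.Build (signed_perm_mx n) (pcan_enumP (@signed_perm_mx_encK n)).

Definition increasing k n (f : {ffun 'I_k -> 'I_n}) : bool :=
  [forall i : 'I_k, forall j : 'I_k, (i < j)%N ==> (f i < f j)%N].

Definition contains n k (A : 'M[int]_n) (tau : 'M[int]_k) : bool :=
  [exists f : {ffun 'I_k -> 'I_n}, exists g : {ffun 'I_k -> 'I_n},
    [&& increasing f, increasing g & mxsub f g A == tau]].

(* B_n(tau) *)
Definition avoiders n k (tau : 'M[int]_k) : {set signed_perm_mx n} :=
  [set A : signed_perm_mx n | ~~ contains A tau].

Definition wilf_equiv k l (sigma : 'M[int]_k) (tau : 'M[int]_l) : Prop :=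
  forall n, (1 <= n)%N -> #|avoiders n sigma| = #|avoiders n tau|.

(* Main.v *)
Require Import Defs.
From mathcomp Require Import all_boot all_order all_algebra.
From mathcomp Require Import zify.

(** The two patterns are exchanged by a sign-changing involution of B_n. In a
    signed permutation matrix [A], call a cell _middle_ if some copy of [chi1]
    lies strictly above and to the left of it and some copy of [chi3] lies
    strictly below and to the right of it, and let [flip] negate the entries in
    the middle cells.

    Copies of [chi1], [chi2], [chi3] that follow each other diagonally form a
    copy of the block-diagonal pattern, since a signed permutation matrix has
    no room for further nonzero entries in the rows and columns that they use
    ([occurs_glue]). Hence, for [chi2] nonempty, [A] contains the pattern
    exactly when it has a copy of [chi2] all of whose rows and columns meet in
    middle cells ([contains_diag3P]), and [flip] turns such a copy into a copy
    of [- chi2].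

    It remains to see that [flip] does not change the set of middle cells, for
    then it is an involution and the argument can be reversed. Let [R] be the
    set of cells having a copy of [chi1] strictly to their upper left. Among
    the copies to the upper left of a given cell, one whose last row is as high
    as possible meets no cell of [R], so [R] is determined by the part of [A]
    outside [R], which [flip] does not touch ([beyond_stable]). The same holds
    for [chi3] and the opposite corner. *)

Set Implicit Arguments.
Unset Strict Implicit.
Unset Printing Implicit Defensive.

Import GRing.Theory.
Local Open Scope ring_scope.

(** * Occurrences of a pattern *)

Definition occurs n k (A : 'M[int]_n) (tau : 'M[int]_k)
    (f g : {ffun 'I_k -> 'I_n}) : bool :=
  [&& increasing f, increasing g & mxsub f g A == tau].

Lemma increasingP k n (f : {ffun 'I_k -> 'I_n}) :
  reflect (forall i j : 'I_k, (i < j)%N -> (f i < f j)%N) (increasing f).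
Proof.
apply: (iffP forallP) => [H i j ij | H i].
  by move/forallP: (H i) => /(_ j) /implyP; apply.
by apply/forallP => j; apply/implyP => /H.
Qed.

Lemma increasing_leq k n (f : {ffun 'I_k -> 'I_n}) (i j : 'I_k) :
  increasing f -> (i <= j)%N -> (f i <= f j)%N.
Proof.
move=> /increasingP Hf; rewrite leq_eqVlt => /orP[/eqP/val_inj -> //|].
by move=> /Hf /ltnW.
Qed.

Lemma containsP n k (A : 'M[int]_n) (tau : 'M[int]_k) :
  reflect (exists f g, occurs A tau f g) (contains A tau).
Proof.
apply: (iffP existsP) => [[f /existsP[g H]] | [f [g H]]]; exists f.
  by exists g.
by apply/existsP; exists g.
Qed.

Lemma occursE n k (A : 'M[int]_n) (tau : 'M[int]_k) f g a b :
  occurs A tau f g -> A (f a) (g b) = tau a b.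
Proof. by case/and3P=> _ _ /eqP <-; rewrite mxE. Qed.

Lemma eq_occurs n k (A A' : 'M[int]_n) (tau : 'M[int]_k)
    (f g : {ffun 'I_k -> 'I_n}) :
  (forall a b, A (f a) (g b) = A' (f a) (g b)) ->
  occurs A tau f g = occurs A' tau f g.
Proof.
move=> eqA; rewrite /occurs; congr [&& _, _ & _ == _].
by apply/matrixP => a b; rewrite !mxE.
Qed.

Lemma occursN n k (A A' : 'M[int]_n) (tau : 'M[int]_k)
    (f g : {ffun 'I_k -> 'I_n}) :
  (forall a b, A' (f a) (g b) = - A (f a) (g b)) ->
  occurs A tau f g -> occurs A' (- tau) f g.
Proof.
move=> eqA /and3P[Hf Hg /eqP <-]; apply/and3P; split=> //.
by apply/eqP/matrixP => a b; rewrite !mxE.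
Qed.

(** * Signed permutation matrices *)

(** Negation stays within [row_col_full], so this property of a pattern can be
    used for [chi2] and [- chi2] alike. *)
Definition row_col_full k (s : 'M[int]_k) : Prop :=
  (forall a, exists b, s a b != 0) /\ (forall b, exists a, s a b != 0).

Lemma row_col_fullN k (s : 'M[int]_k) : row_col_full s -> row_col_full (- s).
Proof.
case=> Hr Hc; split=> x; [have [y Hy] := Hr x | have [y Hy] := Hc x];
  by exists y; rewrite mxE oppr_eq0.
Qed.

Lemma signed_perm_full k (s : signed_perm_mx k) :
  row_col_full (s : 'M[int]_k).
Proof.
have /and3P[_ /forallP Hr /forallP Hc] := valP s; split=> x.
  have /cards1P[y Ey] := Hr x; exists y.
  by have := set11 y; rewrite -Ey inE.
have /cards1P[y Ey] := Hc x; exists y.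
by have := set11 y; rewrite -Ey inE.
Qed.

Lemma signed_perm_row n (A : signed_perm_mx n) i j j' :
  A i j != 0 -> A i j' != 0 -> j = j'.
Proof.
have /and3P[_ /forallP/(_ i)/cards1P[y Ey] _] := valP A.
by move=> H H'; apply: etrans (_ : y = _); [|symmetry];
  apply/set1P; rewrite -Ey inE.
Qed.

Lemma signed_perm_col n (A : signed_perm_mx n) i i' j :
  A i j != 0 -> A i' j != 0 -> i = i'.
Proof.
have /and3P[_ _ /forallP/(_ j)/cards1P[y Ey]] := valP A.
by move=> H H'; apply: etrans (_ : y = _); [|symmetry];
  apply/set1P; rewrite -Ey inE.
Qed.

(** * Block-diagonal patterns *)

Section BlockDiagonal.

Variables (n k1 k2 : nat).

Definition ffun_lpart (f : {ffun 'I_(k1 + k2) -> 'I_n}) : {ffun 'I_k1 -> 'I_n} :=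
  [ffun a => f (lshift k2 a)].

Definition ffun_rpart (f : {ffun 'I_(k1 + k2) -> 'I_n}) : {ffun 'I_k2 -> 'I_n} :=
  [ffun a => f (rshift k1 a)].

Definition ffun_glue (f1 : {ffun 'I_k1 -> 'I_n}) (f2 : {ffun 'I_k2 -> 'I_n}) :
    {ffun 'I_(k1 + k2) -> 'I_n} :=
  [ffun x => match split x with inl a => f1 a | inr b => f2 b end].

Definition entirely_before k l (f1 : {ffun 'I_k -> 'I_n})
    (f2 : {ffun 'I_l -> 'I_n}) : Prop :=
  forall a b, (f1 a < f2 b)%N.

Lemma ffun_glue_lshift f1 f2 a : ffun_glue f1 f2 (lshift k2 a) = f1 a.
Proof. by rewrite ffunE (unsplitK (inl a)). Qed.

Lemma ffun_glue_rshift f1 f2 b : ffun_glue f1 f2 (rshift k1 b) = f2 b.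
Proof. by rewrite ffunE (unsplitK (inr b)). Qed.

Lemma increasing_glue f1 f2 :
  increasing f1 -> increasing f2 -> entirely_before f1 f2 ->
  increasing (ffun_glue f1 f2).
Proof.
move=> /increasingP H1 /increasingP H2 H12; apply/increasingP => i j.
case: (split_ordP i) => a ->; case: (split_ordP j) => b -> /=;
  rewrite ?ffun_glue_lshift ?ffun_glue_rshift //.
- exact: H1.
- by have := ltn_ord b; lia.
- by move=> ab; apply: H2; lia.
Qed.

Lemma increasing_split f :
  increasing f ->
  [/\ increasing (ffun_lpart f), increasing (ffun_rpart f)
    & entirely_before (ffun_lpart f) (ffun_rpart f)].
Proof.
move/increasingP=> H; split; try apply/increasingP; move=> a b;
  rewrite !ffunE => *; apply: H => /=; have := ltn_ord a; lia.
Qed.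

Lemma occurs_split (A : 'M[int]_n) (s : 'M[int]_k1) (t : 'M[int]_k2) f g :
  occurs A (block_mx s 0 0 t) f g ->
  occurs A s (ffun_lpart f) (ffun_lpart g) /\
  occurs A t (ffun_rpart f) (ffun_rpart g).
Proof.
case/and3P=> /increasing_split[f1 f2 _] /increasing_split[g1 g2 _] /eqP E.
split; apply/and3P; split=> //; apply/eqP/matrixP => a b; rewrite !mxE !ffunE.
  by move/matrixP/(_ (lshift k2 a) (lshift k2 b)): E; rewrite block_mxEul mxE.
by move/matrixP/(_ (rshift k1 a) (rshift k1 b)): E; rewrite block_mxEdr mxE.
Qed.

(** The off-diagonal blocks vanish for free: each row and each column of the
    copy of [s] already contains the only nonzero entry that [A] has there. *)
Lemma occurs_glue (A : signed_perm_mx n) (s : 'M[int]_k1) (t : 'M[int]_k2)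
    f1 g1 f2 g2 :
  row_col_full s -> occurs A s f1 g1 -> occurs A t f2 g2 ->
  entirely_before f1 f2 -> entirely_before g1 g2 ->
  occurs A (block_mx s 0 0 t) (ffun_glue f1 f2) (ffun_glue g1 g2).
Proof.
move=> [full_r full_c] Os Ot ltf ltg.
have [inc_f1 inc_g1 _] := and3P Os; have [inc_f2 inc_g2 _] := and3P Ot.
apply/and3P; split; try exact: increasing_glue.
apply/eqP/matrixP => x y; rewrite mxE.
case: (split_ordP x) => a ->; case: (split_ordP y) => b ->;
  rewrite ?ffun_glue_lshift ?ffun_glue_rshift ?block_mxEul ?block_mxEur
    ?block_mxEdl ?block_mxEdr ?mxE; try exact: occursE.
- have [c] := full_r a; rewrite -(occursE _ _ Os) => nz.
  apply/eqP; apply: contraTT (ltg c b) => nz'.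
  by rewrite (signed_perm_row nz nz') ltnn.
- have [c] := full_c b; rewrite -(occursE _ _ Os) => nz.
  apply/eqP; apply: contraTT (ltf c a) => nz'.
  by rewrite (signed_perm_col nz nz') ltnn.
Qed.

End BlockDiagonal.

(** * The cells lying beyond a copy of a pattern *)

(** The weight [p] allows the two corners to be treated at once: for the
    position itself the copy of [tau] lies to the upper left of [(i, j)], for
    the reversed position to the lower right. *)
Definition beyond n k (p : 'I_n -> nat) (tau : 'M[int]_k) (A : 'M[int]_n)
    (i j : 'I_n) : bool :=
  [exists f : {ffun 'I_k -> 'I_n}, exists g : {ffun 'I_k -> 'I_n},
    [&& occurs A tau f g, [forall a, (p (f a) < p i)%N]
      & [forall b, (p (g b) < p j)%N]]].

Section Beyond.

Variables (n k : nat) (p : 'I_n -> nat) (tau : 'M[int]_k).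
Implicit Types A : 'M[int]_n.

Lemma beyondP A i j :
  reflect (exists f g, [/\ occurs A tau f g, forall a, (p (f a) < p i)%N
                         & forall b, (p (g b) < p j)%N])
    (beyond p tau A i j).
Proof.
apply: (iffP existsP) => [[f /existsP[g /and3P[O /forallP Hf /forallP Hg]]] |
                          [f [g [O Hf Hg]]]]; exists f.
  by exists g.
by apply/existsP; exists g; apply/and3P; split=> //; apply/forallP.
Qed.

Lemma beyond_trans A i j i' j' :
  (p i < p i')%N -> (p j < p j')%N -> beyond p tau A i j ->
  beyond p tau A i' j'.
Proof.
move=> lti ltj /beyondP[f [g [O Hf Hg]]]; apply/beyondP; exists f, g.
by split=> // x; [apply: ltn_trans (Hf x) lti | apply: ltn_trans (Hg x) ltj].
Qed.

(** If a cell of the copy lies itself beyond a copy, then the latter is closer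
    to the corner, so the descent stops at a copy free of such cells. *)
Lemma beyond_first A i j :
  beyond p tau A i j ->
  exists f g, [/\ occurs A tau f g, forall a, (p (f a) < p i)%N,
    forall b, (p (g b) < p j)%N
    & forall a b, ~~ beyond p tau A (f a) (g b)].
Proof.
have [m] := ubnP (p i); elim: m i j => // m IH i j lt_im.
case/beyondP=> f [g [O Hf Hg]].
case: (boolP [exists a, exists b, beyond p tau A (f a) (g b)]); last first.
  move=> none; exists f, g; split=> // a b; apply: contra none => H.
  by apply/existsP; exists a; apply/existsP; exists b.
case/existsP=> a /existsP[b Hab].
have [|f' [g' [O' Hf' Hg' none]]] := IH (f a) (g b) _ Hab.
  exact: leq_trans (Hf a) lt_im.
by exists f', g'; split=> // x;
  [apply: ltn_trans (Hf' x) (Hf a) | apply: ltn_trans (Hg' x) (Hg b)].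
Qed.

(** The cells beyond a copy of [tau] only depend on the entries elsewhere:
    first copies lie outside this set, and so does every copy to be found
    before a cell outside it. *)
Lemma beyond_stable A A' :
  (forall i j, ~~ beyond p tau A i j -> A i j = A' i j) ->
  beyond p tau A' =2 beyond p tau A.
Proof.
move=> eqA i j; apply/idP/idP => [H'|].
  apply: contraT => nH; rewrite -(negbTE nH).
  case/beyondP: H' => f [g [O Hf Hg]]; apply/beyondP; exists f, g; split=> //.
  rewrite (eq_occurs (A' := A')) // => a b; apply: eqA.
  by apply: contra nH; apply: beyond_trans.
case/beyond_first=> f [g [O Hf Hg none]]; apply/beyondP; exists f, g; split=> //.
by rewrite -(eq_occurs (A := A)) // => a b; apply: eqA.
Qed.

End Beyond.

(** * The sign-changing involution *)

Section Flip.

Variables (n k1 k3 : nat) (chi1 : signed_perm_mx k1) (chi3 : signed_perm_mx k3).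

Definition middle (A : 'M[int]_n) (i j : 'I_n) : bool :=
  beyond (@nat_of_ord n) (chi1 : 'M[int]_k1) A i j &&
  beyond (fun x : 'I_n => rev_ord x) (chi3 : 'M[int]_k3) A i j.

Definition flip_mx (A : 'M[int]_n) : 'M[int]_n :=
  \matrix_(i, j) if middle A i j then - A i j else A i j.

Lemma middle_flip A : middle (flip_mx A) =2 middle A.
Proof.
by move=> i j; congr (_ && _); apply: beyond_stable => {}i {}j /negPf H;
  rewrite mxE /middle H ?andbF.
Qed.

Lemma flip_mxK : involutive flip_mx.
Proof.
move=> A; apply/matrixP => i j; rewrite !mxE middle_flip.
by case: (middle A i j); rewrite ?opprK.
Qed.

Lemma flip_mx_eq0 A i j : (flip_mx A i j == 0) = (A i j == 0).
Proof. by rewrite mxE; case: ifP; rewrite ?oppr_eq0. Qed.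

Lemma flip_subproof (A : signed_perm_mx n) : is_signed_perm_mx (flip_mx A).
Proof.
have /and3P[/forallP HA /forallP Hr /forallP Hc] := valP A.
apply/and3P; split; apply/forallP => i.
- apply/forallP => j; have /forallP/(_ j) := HA i; rewrite mxE.
  by case: ifP => // _; rewrite !inE => /or3P[] /eqP ->.
- by under eq_finset => j do rewrite flip_mx_eq0; apply: Hr.
- by under eq_finset => j do rewrite flip_mx_eq0; apply: Hc.
Qed.

Definition flip (A : signed_perm_mx n) : signed_perm_mx n :=
  SignedPermMx (flip_subproof A).

Lemma flipK : involutive flip.
Proof. by move=> A; apply/val_inj/flip_mxK. Qed.

Definition diag3 k2 (chi2 : 'M[int]_k2) : 'M[int]_(k1 + (k2 + k3)) :=
  block_mx (chi1 : 'M[int]_k1) 0 0 (block_mx chi2 0 0 (chi3 : 'M[int]_k3)).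

(** In the backward direction the copy of [chi1] comes from the first cell of
    the copy of [chi2] and the copy of [chi3] from its last cell; an empty
    [chi2] would have neither. *)
Lemma contains_diag3P k2 (chi2 : 'M[int]_k2.+1) (A : signed_perm_mx n) :
  row_col_full chi2 ->
  reflect (exists f g, occurs A chi2 f g /\ forall a b, middle A (f a) (g b))
    (contains A (diag3 chi2)).
Proof.
move=> full2; apply: (iffP (containsP _ _)) => [[f [g O]] | [f [g [O mid]]]].
  have [inc_f inc_g _] := and3P O.
  have [O1 O23] := occurs_split O; have [O2 O3] := occurs_split O23.
  have [_ inc_f' f_12] := increasing_split inc_f.
  have [_ inc_g' g_12] := increasing_split inc_g.
  have [_ _ f_23] := increasing_split inc_f'.
  have [_ _ g_23] := increasing_split inc_g'.
  exists (ffun_lpart (ffun_rpart f)), (ffun_lpart (ffun_rpart g)).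
  split=> // a b; apply/andP; split; apply/beyondP.
    exists (ffun_lpart f), (ffun_lpart g).
    by split=> // x; rewrite ![in X in (_ < X)%N]ffunE;
      [have := f_12 x (lshift _ a) | have := g_12 x (lshift _ b)];
      rewrite ![in X in (_ < X)%N -> _]ffunE.
  exists (ffun_rpart (ffun_rpart f)), (ffun_rpart (ffun_rpart g)).
  split=> // x /=;
    [have := f_23 a x | have := g_23 b x];
    set u := ffun_lpart _ _; set v := ffun_rpart _ _;
    have := ltn_ord u; have := ltn_ord v; lia.
have [inc_f inc_g _] := and3P O.
have /andP[/beyondP[f1 [g1 [O1 f1_lt g1_lt]]] _] := mid ord0 ord0.
have /andP[_ /beyondP[f3 [g3 [O3 f3_gt g3_gt]]]] := mid ord_max ord_max.
have before1 (h1 : {ffun 'I_k1 -> 'I_n}) (h : {ffun 'I_k2.+1 -> 'I_n}) :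
    increasing h -> (forall a, (h1 a < h ord0)%N) -> entirely_before h1 h.
  by move=> inc lt a b; apply: leq_trans (lt a) (increasing_leq inc _).
have before3 (h3 : {ffun 'I_k3 -> 'I_n}) (h : {ffun 'I_k2.+1 -> 'I_n}) :
    increasing h -> (forall a, (rev_ord (h3 a) < rev_ord (h ord_max))%N) ->
    entirely_before h h3.
  move=> inc lt b a; have := lt a => /=.
  have := increasing_leq (j := ord_max) inc (leq_ord b).
  have := ltn_ord (h ord_max); have := ltn_ord (h3 a); lia.
have before13 (h1 : {ffun 'I_k1 -> 'I_n}) (h : {ffun 'I_k2.+1 -> 'I_n})
    (h3 : {ffun 'I_k3 -> 'I_n}) :
    entirely_before h1 h -> entirely_before h h3 ->
    entirely_before h1 (ffun_glue h h3).
  move=> lt1 lt3 a x; case: (split_ordP x) => b ->.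
    by rewrite ffun_glue_lshift.
  by rewrite ffun_glue_rshift; apply: ltn_trans (lt1 a ord0) (lt3 ord0 b).
exists (ffun_glue f1 (ffun_glue f f3)), (ffun_glue g1 (ffun_glue g g3)).
apply: occurs_glue => //; first exact: signed_perm_full.
- by apply: occurs_glue => //; apply: before3.
- by apply: before13; [apply: before1 | apply: before3].
- by apply: before13; [apply: before1 | apply: before3].
Qed.

Lemma contains_flip k2 (chi2 : 'M[int]_k2.+1) (A : signed_perm_mx n) :
  row_col_full chi2 ->
  contains A (diag3 chi2) -> contains (flip A) (diag3 (- chi2)).
Proof.
move=> full2 /(contains_diag3P _ full2)[f [g [O mid]]].
apply/contains_diag3P; first exact: row_col_fullN.
exists f, g; split=> [|a b]; last by rewrite middle_flip.
by apply: occursN O => a b; rewrite mxE mid.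
Qed.

Lemma contains_flipE k2 (chi2 : 'M[int]_k2.+1) (A : signed_perm_mx n) :
  row_col_full chi2 ->
  contains (flip A) (diag3 (- chi2)) = contains A (diag3 chi2).
Proof.
move=> full2; apply/idP/idP => [H|]; last exact: contains_flip.
by rewrite -(flipK A) -[chi2]opprK; apply: contains_flip H; apply: row_col_fullN.
Qed.

End Flip.

Theorem corollary3p2 (k1 k2 k3 : nat) (chi1 : signed_perm_mx k1)
    (chi2 : signed_perm_mx k2) (chi3 : signed_perm_mx k3) :
  wilf_equiv
    (block_mx (chi1 : 'M[int]_k1) 0 0
      (block_mx (chi2 : 'M[int]_k2) 0 0 (chi3 : 'M[int]_k3)))
    (block_mx (chi1 : 'M[int]_k1) 0 0
      (block_mx (- (chi2 : 'M[int]_k2)) 0 0 (chi3 : 'M[int]_k3))).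
Proof.
case: k2 chi2 => [|k2] chi2 n _.
  (* The empty matrix is its own opposite. *)
  by have -> : - (chi2 : 'M[int]_0) = chi2 by apply/matrixP => -[].
rewrite -[RHS](card_preimset _ (inv_inj (flipK (n := n) chi1 chi3))).
apply: eq_card => A; rewrite !inE; congr (~~ _); symmetry.
exact/contains_flipE/signed_perm_full.
Qed.
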